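(* Let $n,m\geq1$ and let $(S_1,\dots,S_{n+m})$ be an exchangeable random vector of real scores with almost surely no ties. Let $p_i=\frac1{n+1}\big(1+\sum_{j=1}^n\mathbf{1}\{S_j\geq S_{n+i}\}\big)$, $i\in\{1,\dots,m\}$, and $\widehat F_m(t)=m^{-1}\sum_{i=1}^m\mathbf{1}\{p_i\leq t\}$. Let $\mathcal K\subset\{1,\dots,m\}$ and let $(t_k(\lambda))_{\lambda\in[0,1],k\in\mathcal K}$ be a template, i.e. for each $k\in\mathcal K$, $t_k(0)=0$ and $t_k(\cdot)$ is continuous and increasing on $[0,1]$. For $\delta\in(0,1)$ let $$\lambda(\delta,n,m)=\max\Big\{\lambda\in\Lambda:\mathbb{P}_{\boldsymbol p\sim P_{n,m}}\Big(\min_{k\in\mathcal K}t_k^{-1}(p_{(k)})>\lambda\Big)\geq1-\delta\Big\},$$ where $\Lambda=\{t_k^{-1}(\ell/(n+1)):k\in\mathcal K,\ell\in\{1,\dots,n+1\}\}$ and $p_{(1)}\leq\dots\leq p_{(m)}$ are the order statistics of $\boldsymbol p$. Then $$\mathbb{P}\Big(\forall k\in\mathcal K:\ \widehat F_m\big(t_k(\lambda(\delta,n,m))\big)\leq\frac km\Big)\geq1-\delta.$$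
   Context: $P_{n,m}$: distribution of $(q_1,\dots,q_m)$ where $U_1,\dots,U_n$ i.i.d. $\mathrm{Unif}[0,1]$ and, given $U$, $q_1,\dots,q_m$ i.i.d. with distribution $P^U$ on $\{\ell/(n+1):\ell\leq n+1\}$ assigning mass $U_{(\ell)}-U_{(\ell-1)}$ to $\ell/(n+1)$ (with $U_{(1)}\leq\dots\leq U_{(n)}$ the order statistics, $U_{(0)}=0$, $U_{(n+1)}=1$). Here $t_k^{-1}(x):=\sup\{\lambda\in[0,1]:t_k(\lambda)\leq x\}$ for $x\geq0$, and $\lambda(\delta,n,m):=0$ if the set in its definition is empty. *)

(* Defs.v *)
From HB Require Import structures.
From mathcomp Require Import all_boot all_order all_algebra all_fingroup.
From mathcomp Require Import all_classical all_reals all_analysis.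
Set Implicit Arguments. Unset Strict Implicit. Unset Printing Implicit Defensive.
Import Order.TTheory GRing.Theory Num.Theory.
Import numFieldNormedType.Exports.
Local Open Scope classical_set_scope.
Local Open Scope ring_scope.

Section Defs.
Variable R : realType.

Definition ordstat (N : nat) (q : 'I_N -> R) (k : nat) : R :=
  nth 0 (sort <=%R [seq q i | i <- enum 'I_N]) k.-1.

Definition tinv (t : R -> R) (x : R) : R :=
  sup [set l | 0 <= l <= 1 /\ t l <= x].

(* conformal p-value p_i, i : 'I_m (index i stands for i+1 in the paper) *)
Definition pval (n m : nat) (s : 'I_(n + m) -> R) (i : 'I_m) : R :=
  (1 + (#|[set j : 'I_n | s (rshift n i) <= s (lshift m j)]|)%:R) / (n.+1)%:R.

Definition Fhat (n m : nat) (s : 'I_(n + m) -> R) (x : R) : R :=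
  (#|[set i : 'I_m | pval s i <= x]|)%:R / m%:R.

Definition ustat (n : nat) (u : 'I_n -> R) (l : nat) : R :=
  if l == 0%N then 0 else if l == n.+1 then 1 else ordstat u l.

(* P^U(l/(n+1)) = U_(l) - U_(l-1), for l = 1..n+1 *)
Definition PUmass (n : nat) (u : 'I_n -> R) (l : nat) : R :=
  ustat u l - ustat u l.-1.

(* conditional probability, given U = u, that (q_1..q_m) i.i.d. ~ P^U lies in E.
   a : 'I_m -> 'I_n.+1 encodes q_i = (a i + 1)/(n+1). *)
Definition condprob (n m : nat) (u : 'I_n -> R) (E : ('I_m -> R) -> Prop) : R :=
  \sum_(a : {ffun 'I_m -> 'I_n.+1})
     (\prod_(i : 'I_m) PUmass u (a i).+1) *
     (if `[< E (fun i => (a i).+1%:R / (n.+1)%:R) >] then 1 else 0).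

(* Iterated integral over [0,1]^k of f with respect to Lebesgue measure,
   i.e. expectation of f(U_0,...,U_{k-1}) for U_j i.i.d. Unif[0,1]
   (coordinates >= k are irrelevant / set to 0). *)
Fixpoint iint (k : nat) (f : (nat -> R) -> R) : R :=
  match k with
  | 0%N => f (fun _ => 0)
  | k'.+1 => Rintegral (@lebesgue_measure R) `[0%R, 1%R]
      (fun x => iint k' (fun v => f (fun j => if j == k' then x else v j)))
  end.

Definition Pnm (n m : nat) (E : ('I_m -> R) -> Prop) : R :=
  iint n (fun v => condprob (fun i : 'I_n => v (nat_of_ord i)) E).

(* the event { min_{k in K} t_k^{-1}(p_(k)) > lam } (k : 'I_m.+1 stands for k) *)
Definition minevent (m : nat) (K : {set 'I_m.+1}) (t : 'I_m.+1 -> R -> R)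
  (lam : R) (q : 'I_m -> R) : Prop :=
  forall k, k \in K -> lam < tinv (t k) (ordstat q k).

Definition Lambda (n m : nat) (K : {set 'I_m.+1}) (t : 'I_m.+1 -> R -> R) : set R :=
  [set x | exists k, exists l : nat, k \in K /\ (1 <= l <= n.+1)%N /\
           x = tinv (t k) (l%:R / (n.+1)%:R)].

(* lambda(delta,n,m): max of a finite set (= its sup), 0 if the set is empty *)
Definition lamsel (n m : nat) (K : {set 'I_m.+1}) (t : 'I_m.+1 -> R -> R)
  (delta : R) : R :=
  let A := [set x | Lambda n K t x /\ 1 - delta <= Pnm n (minevent K t x)] in
  if `[< A !=set0 >] then sup A else 0.

Definition template_fun (f : R -> R) : Prop :=
  [/\ f 0 = 0, {within `[0%R, 1%R], continuous f}
    & {in `[0%R, 1%R] &, forall x y, x < y -> f x < f y}].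

End Defs.

(* Main.v *)
(** The law of the conformal p-values is computed exactly on both sides. Write
    [a i] for the number of calibration scores above the test score [i], and
    [c_l] for the number of tests [i] with [a i = l].

    - Exchangeability and the absence of ties make all [(n + m)!] rankings of
      the scores equally likely, and [n! * prod_l c_l!] rankings produce a given
      [a]: reading a ranking from the top, the next element must be one of the
      remaining tests of the current level, or any remaining calibration score
      once that level is exhausted.
    - Under [P_{n,m}], [a] has probability
      [E prod_l (U_(l+1) - U_(l))^c_l = n! * prod_l c_l! / (n + m)!]. Integrating
      out the innermost variable merges two adjacent gaps by a beta integral, so
      this Dirichlet integral follows by induction without Fubini's theorem.

    Hence [min_k t_k^-1(p_(k)) > lambda] has the same probability for the
    conformal p-values as under [P_{n,m}], and on this event
    [t_k(lambda) < p_(k)], so fewer than [k] p-values are below [t_k(lambda)]. *)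
Require Import Defs.
From HB Require Import structures.
From mathcomp Require Import all_boot all_order all_algebra all_fingroup.
From mathcomp Require Import all_classical all_reals all_analysis.
From mathcomp Require Import measurable_realfun.
From mathcomp Require Import ring.
Set Implicit Arguments. Unset Strict Implicit. Unset Printing Implicit Defensive.
Import Order.TTheory GRing.Theory Num.Theory.
Import numFieldNormedType.Exports.
Local Open Scope classical_set_scope.
Local Open Scope ring_scope.

(** * Integrals with known value and the beta integral on an interval *)

Section IntegralValue.
Context {R : realType}.
Implicit Types (a b c v : R) (f g : R -> R).
Local Notation mu := (@lebesgue_measure R).

(** Integrability travels with the value because additivity of [Rintegral] requires it. *)
Definition has_Rint a b f v : Prop :=
  mu.-integrable `[a, b] (EFin \o f) /\ Rintegral mu `[a, b] f = v.

Lemma has_Rint_ext a b f g v :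
  {in `[a, b], f =1 g} -> has_Rint a b f v -> has_Rint a b g v.
Proof.
move=> fg; have fg' : {in `[a, b]%classic, f =1 g}.
  by move=> x; rewrite inE => xab; apply: fg.
move=> [fi <-]; split.
  by apply: eq_integrable fi => // x xab /=; rewrite fg'.
by apply: eq_Rintegral => x xab; rewrite fg'.
Qed.

Lemma has_RintZ a b f v k : has_Rint a b f v -> has_Rint a b (fun x => k * f x) (k * v).
Proof.
move=> [fi <-]; split; last by rewrite RintegralZl.
rewrite (_ : _ \o _ = fun x => (k%:E * (EFin \o f) x)%E); last by apply/funext.
exact: integrableZl.
Qed.

Lemma has_RintD a b f g v v' : has_Rint a b f v -> has_Rint a b g v' ->
  has_Rint a b (fun x => f x + g x) (v + v').
Proof.
move=> [fi <-] [gi <-]; split; last by rewrite RintegralD.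
rewrite (_ : _ \o _ = (EFin \o f) \+ (EFin \o g))%E; last by apply/funext.
exact: integrableD.
Qed.

Lemma has_Rint0 a b : has_Rint a b (fun=> 0) 0.
Proof.
split; last by rewrite Rintegral_cst// mul0r.
exact: integrable0.
Qed.

Lemma has_Rint_sum (I : eqType) (s : seq I) a b (F : I -> R -> R) (v : I -> R) :
  (forall i, i \in s -> has_Rint a b (F i) (v i)) ->
  has_Rint a b (fun x => \sum_(i <- s) F i x) (\sum_(i <- s) v i).
Proof.
elim: s => [|i s IH] Fi.
  by rewrite big_nil; under eq_fun do rewrite big_nil; apply: has_Rint0.
rewrite big_cons; under eq_fun do rewrite big_cons.
apply: has_RintD; first by apply: Fi; rewrite mem_head.
by apply: IH => j js; apply: Fi; rewrite inE js orbT.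
Qed.

(** The union is made disjoint by using []b, c]]; dropping the null point [b] leaves the second
    integral unchanged. *)
Lemma has_Rint_cat a b c f v v' : a <= b -> b <= c ->
  has_Rint a b f v -> has_Rint b c f v' -> has_Rint a c f (v + v').
Proof.
move=> ab bc [fi <-] [gi <-].
have acE : `[a, c]%classic = `[a, b]%classic `|` `]b, c]%classic :> set R.
  by rewrite -itv_bndbnd_setU// bnd_simp.
have gi' : mu.-integrable `]b, c] (EFin \o f).
  by apply: integrableS gi => //; apply: subset_itvr; rewrite bnd_simp.
have disj : [disjoint `[a, b]%classic & `]b, c]%classic].
  apply/disj_setPS => y [/=]; rewrite 2!in_itv/= => /andP[_ yx] /andP[].
  by rewrite ltNge yx.
have fgi : mu.-integrable `[a, c] (EFin \o f).
  move/integrableP : fi => [mf fi]; move/integrableP : gi' => [mg gi'].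
  apply/integrableP; rewrite acE; split; first exact/measurable_funU.
  rewrite ge0_integral_setU//; first exact: lte_add_pinfty.
  by apply/measurable_funU => //; split; apply: measurableT_comp.
split => //; rewrite acE Rintegral_setU//; last by rewrite -acE.
by rewrite Rintegral_itv_obnd_cbnd.
Qed.

Lemma has_Rint_poly a b (F : {poly R}) : a <= b ->
  has_Rint a b (horner F^`()) (F.[b] - F.[a]).
Proof.
have ci (p : {poly R}) : {within `[a, b], continuous (horner p)}.
  by apply: continuous_subspaceT; apply: continuous_horner.
move=> ab; split.
  by apply: continuous_compact_integrable => //; exact: segment_compact.
move: ab; rewrite le_eqVlt => /predU1P[<-|ab].
  by rewrite set_itv1 Rintegral_set1 subrr.
rewrite /Rintegral (@continuous_FTC2 _ _ (horner F)) //.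
  split.
  - by move=> x _; apply: derivable_horner.
  - by apply: cvg_at_right_filter; apply: continuous_horner.
  - by apply: cvg_at_left_filter; apply: continuous_horner.
by move=> x _; rewrite derivE.
Qed.

(** Integration by parts passes from [(p, q.+1)] to [(p.+1, q)], with a boundary term that vanishes
    at both [a] and [b]. Working with polynomials keeps the derivative formal. *)
Lemma beta_antiderivative a b p q :
  exists2 F : {poly R}, F^`() = ('X - a%:P) ^+ p * (b%:P - 'X) ^+ q
    & F.[b] - F.[a] = (p`! * q`!)%:R / (p + q).+1`!%:R * (b - a) ^+ (p + q).+1.
Proof.
have kp k : (k.+1%:R^-1)%:P * k.+1%:R = 1 :> {poly R}.
  by rewrite -polyC_natr -polyCM mulVf// pnatr_eq0.
have fn0 k : k`!%:R != 0 :> R by rewrite pnatr_eq0 -lt0n fact_gt0.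
elim: q p => [|q IH] p.
  exists ((p.+1%:R^-1)%:P * ('X - a%:P) ^+ p.+1).
    rewrite derivM derivC deriv_exp derivB derivX derivC subr0 mul1r mul0r /=.
    by rewrite add0r expr0 mulr1 -[X in _ * X]mulr_natl mulrA kp mul1r.
  rewrite addn0 !hornerE subrr expr0n /= mulr0 subr0 factS. rewrite !natrM.
  by congr (_ * _); field; rewrite fn0 nat1r pnatr_eq0.
have [F F' Fba] := IH p.+1.
exists ((p.+1%:R^-1)%:P *
    (('X - a%:P) ^+ p.+1 * (b%:P - 'X) ^+ q.+1 + F *+ q.+1)).
  rewrite derivM derivC mul0r add0r derivD derivMn F' derivM !deriv_exp !derivB.
  rewrite derivX !derivC subr0 sub0r mul1r mulN1r /=.
  move: (kp p); set u := 'X - a%:P; set v := b%:P - 'X; set k := _%:P => kp1.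
  rewrite -[RHS]mul1r -[in RHS]kp1.
  by rewrite mulr_natr mulNrn mulrN mulrnAr addrNK !mulrnAl mulrnAr.
rewrite !hornerE !hornerMn !subrr !exprS !mul0r mulr0 !add0r.
rewrite -mulrBr -mulrnBl Fba -mulr_natr -exprS !addSn !addnS !factS !natrM.
have h1 : p.+1%:R != 0 :> R by rewrite pnatr_eq0.
have h2 : (p + q).+2%:R != 0 :> R by rewrite pnatr_eq0.
have h3 : (p + q).+1%:R != 0 :> R by rewrite pnatr_eq0.
move: (fn0 (p + q)%N) h1 h2 h3.
move: (p + q)`!%:R (p + q).+1%:R (p + q).+2%:R p.+1%:R => x y z t x0 t0 z0 y0.
by field; rewrite x0 y0 z0 t0.
Qed.

Lemma has_Rint_beta a b p q : a <= b ->
  has_Rint a b (fun x => (x - a) ^+ p * (b - x) ^+ q)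
    ((p`! * q`!)%:R / (p + q).+1`!%:R * (b - a) ^+ (p + q).+1).
Proof.
move=> ab; have [F F' <-] := beta_antiderivative a b p q.
apply: has_Rint_ext (has_Rint_poly F ab) => x _.
by rewrite F' !hornerE.
Qed.

End IntegralValue.

(** * Counting the rankings with prescribed test levels *)

Section PatternCount.
Context {X : eqType} (cal : pred X) (g : X -> nat).

(* [h] counts the [cal] elements met so far: [good 0 s] says that each other
   element [x] of [s] is preceded by exactly [g x] elements satisfying [cal]. *)
Fixpoint good (h : nat) (s : seq X) : bool :=
  if s is x :: s' then
    if cal x then good h.+1 s' else (g x == h) && good h s'
  else true.

Let at_level l := [pred x | ~~ cal x && (g x == l)].

Lemma good_ge h s x : good h s -> x \in s -> ~~ cal x -> (h <= g x)%N.
Proof.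
elim: s h => //= y s IH h; rewrite inE.
case: ifP => [cy|/negbT cy].
  move=> gs /predU1P[->|xs]; first by rewrite cy.
  by move=> cx; apply/ltnW/(IH _ gs).
by move=> /andP[/eqP gy gs] /predU1P[->|xs] cx; [rewrite gy|apply: IH gs xs cx].
Qed.

Lemma sum_mem_count (a : pred X) s : (\sum_(x <- s) a x = count a s)%N.
Proof. by rewrite -sumn_count sumnE big_map. Qed.

(** Induction on the length, by the head of the permutation. The bounds on [g] say that each
    remaining test is neither overtaken by the counter nor out of its reach, and both branches
    preserve them. *)
Lemma count_good_permutations h s : uniq s ->
  (forall x, x \in s -> ~~ cal x -> (h <= g x <= h + count cal s)%N) ->
  count (good h) (permutations s) =
  ((count cal s)`! * \prod_(h <= l < (h + count cal s).+1) (count (at_level l) s)`!)%N.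
Proof.
move Dn: (size s) => n; elim: n h s Dn => [|n IH] h s.
  move=> /size0nil -> _ _ /=.
  by rewrite big1.
move=> sn us sg.
have s0 : (0 < size s)%N by rewrite sn.
rewrite (seq.permP (permutationsE s0)) undup_id// count_flatten -map_comp sumnE big_map.
under eq_bigr do rewrite /= count_map.
set N := count cal s.
have remE p x : x \in s -> (count p (rem x s) = count p s - p x)%N.
  by move=> xs; rewrite count_rem xs.
have szrem x : x \in s -> size (rem x s) = n by move=> xs; rewrite size_rem// sn.
have [/hasP[z zs /andP[cz /eqP gz]]|/hasPn nolev] := boolP (has (at_level h) s).
  set C := count (at_level h) s.
  set Q := (\prod_(h.+1 <= l < (h + N).+1) (count (at_level l) s)`!)%N.
  have C0 : (0 < C)%N by rewrite -has_count; apply/hasP; exists z; rewrite //= cz gz/=.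
  have -> : (\sum_(x <- s) count (fun t => good h (x :: t)) (permutations (rem x s)) =
             \sum_(x <- s) at_level h x * (N`! * (C.-1`! * Q)))%N.
    rewrite big_seq [RHS]big_seq; apply: eq_bigr => x xs /=.
    have [cx|cx] /= := boolP (cal x).
      (* A calibration head would move the counter past [h] while the test [z] of level [h] is still
         to come. *)
      rewrite mul0n; apply/eqP; rewrite -leqn0 leqNgt -has_count; apply/hasPn => t.
      rewrite mem_permutations => /perm_mem tE; apply/negP => gt.
      have zt : z \in t.
        by rewrite tE mem_rem_uniq// inE zs andbT; apply: contraNneq cz => ->.
      by have := good_ge gt zt cz; rewrite gz ltnn.
    have [gx|gx] /= := eqVneq (g x) h; last by rewrite mul0n count_pred0.
    have cr : count cal (rem x s) = N by rewrite remE// (negbTE cx) subn0.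
    rewrite mul1n (IH _ (rem x s)) ?rem_uniq ?szrem ?cr//; last first.
      by move=> y /mem_rem; apply: sg.
    rewrite big_ltn ?ltnS ?leq_addr// remE// /at_level /= cx gx eqxx /= subn1.
    congr (_ * (_ * _))%N; rewrite big_nat [RHS]big_nat.
    apply: eq_bigr => l /andP[hl _]; rewrite remE//= cx gx (ltn_eqF hl).
    by rewrite subn0.
  rewrite -big_distrl /= (sum_mem_count (at_level h)).
  rewrite [in RHS]big_ltn ?ltnS ?leq_addr// -/C -/Q mulnCA; congr (_ * _)%N.
  by rewrite mulnA -[in RHS](prednK C0) factS prednK.
have hg x : x \in s -> ~~ cal x -> (h < g x)%N.
  move=> xs cx; move: (sg x xs cx) (nolev x xs) => /andP[hx _] /=.
  by rewrite cx /= ltn_neqAle eq_sym hx andbT.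
have -> : (\sum_(x <- s) count (fun t => good h (x :: t)) (permutations (rem x s)) =
           \sum_(x <- s) cal x * (N.-1`! *
              \prod_(h.+1 <= l < (h + N).+1) (count (at_level l) s)`!))%N.
  rewrite big_seq [RHS]big_seq; apply: eq_bigr => x xs /=.
  have [cx|cx] /= := boolP (cal x); last first.
    by rewrite (gtn_eqF (hg x xs cx)) count_pred0.
  have N0 : (0 < N)%N by rewrite -has_count; apply/hasP; exists x.
  have cr : count cal (rem x s) = N.-1 by rewrite remE// cx subn1.
  have hN : (h.+1 + N.-1 = h + N)%N by rewrite addSnnS prednK.
  rewrite mul1n (IH _ (rem x s)) ?rem_uniq ?szrem ?cr ?hN//; last first.
    move=> y /mem_rem ys cy; rewrite hg//=.
    by case/andP: (sg y ys cy).
  congr (_ * _)%N; apply: eq_bigr => l _; rewrite remE//= cx /= subn0 //.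
rewrite -big_distrl /= sum_mem_count -/N.
rewrite [in RHS]big_ltn ?ltnS ?leq_addr//.
have -> : count (at_level h) s = 0%N.
  by apply/eqP; rewrite -leqn0 leqNgt -has_count; apply/hasPn.
rewrite mul1n mulnA; have [N0|N0] := posnP N; last first.
  by rewrite -[in RHS](prednK N0) factS prednK.
(* With no calibration element and no test of level [h] left, any remaining test would satisfy
   [h < g x <= h]. *)
have [x xs] : exists x, x \in s by case: (s) s0 => // x ? _; exists x; rewrite mem_head.
have [cx|cx] := boolP (cal x).
  by move/eqP: N0; rewrite -leqn0 leqNgt -has_count => /hasPn/(_ x xs); rewrite cx.
by move: (sg x xs cx) (hg x xs cx); rewrite -/N N0 addn0; case: ltngtP.
Qed.

End PatternCount.

(** * Dirichlet moments of uniform spacings as iterated integrals *)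

Section GapIntegral.
Context {R : realType}.
Implicit Types (lo x y : R) (s : seq R) (c : seq nat).
Local Notation mu := (@lebesgue_measure R).

(* For sorted [s] in [[lo, 1]], the product of the powers [c] of the successive
   gaps of [lo :: rcons s 1]. *)
Fixpoint gaps lo s c : R :=
  if s is y :: s' then (y - lo) ^+ head 0%N c * gaps y s' (behead c)
  else (1 - lo) ^+ head 0%N c.

Fixpoint insert x s : seq R :=
  if s is y :: s' then if x <= y then x :: s else y :: insert x s' else [:: x].

(* Integrating out the point that separates two adjacent gaps with exponents
   [k] and [l] leaves one gap with exponent [k + l + 1] and a beta factor. *)
Fixpoint merges c : seq (R * seq nat) :=
  if c is k :: c' then
    if c' is l :: c'' then
      ((k`! * l`!)%:R / (k + l).+1`!%:R, (k + l).+1 :: c'') ::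
      [seq (p.1, k :: p.2) | p <- merges c']
    else [::]
  else [::].

Lemma insert_sortE x s : sort <=%R (x :: s) = insert x (sort <=%R s).
Proof.
have ins_perm u : perm_eq (insert x u) (x :: u).
  elim: u => //= y u IH; case: ifP => // _.
  rewrite -(perm_cons y) in IH; apply: perm_trans IH _.
  by apply/seq.permP => p /=; rewrite addnCA.
have ins_path y u : y <= x -> path <=%R y u -> path <=%R y (insert x u).
  elim: u y => [|z u IH] y yx /=; first by rewrite yx.
  case/andP => yz zu; case: ifP => xz /=; first by rewrite yx xz.
  by rewrite yz IH// ltW// ltNge xz.
have ins_sorted u : sorted <=%R u -> sorted <=%R (insert x u).
  case: u => //= y u yu; case: ifP => xy /=; first by rewrite xy.
  by rewrite ins_path// ltW// ltNge xy.
apply: (sorted_eq le_trans le_anti).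
- exact: sort_sorted (@le_total _ R) _.
- by apply/ins_sorted/sort_sorted/le_total.
rewrite perm_sort perm_sym; apply: perm_trans (ins_perm _) _.
by rewrite perm_cons perm_sort.
Qed.

(** Split the range of [x] at the first point [y]: below it the new point cuts the first gap, a beta
    integral; above it the first factor is constant and induction applies. *)
Lemma has_Rint_gaps lo s c : path <=%R lo (rcons s 1) -> size c = (size s).+2 ->
  has_Rint lo 1 (fun x => gaps lo (insert x s) c)
    (\sum_(p <- merges c) p.1 * gaps lo s p.2).
Proof.
elim: s lo c => [|y s IH] lo [|k [|l c]]//=.
  by case: c => // /andP[lo1 _] _; rewrite big_seq1; exact: has_Rint_beta.
move=> /andP[loy ys] [sc].
have y1 : y <= 1.
  have /allP := order_path_min le_trans ys.
  by apply; rewrite mem_rcons mem_head.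
rewrite big_cons big_map; apply: (has_Rint_cat loy y1).
  rewrite /= mulrA [X in has_Rint _ _ _ X]mulrC.
  apply: has_Rint_ext (has_RintZ (gaps y s c) (has_Rint_beta k l loy)) => x.
  by rewrite in_itv /= => /andP[_ xy]; rewrite xy /=; ring.
have -> : \sum_(p <- merges (l :: c)) (p.1, k :: p.2).1 *
    ((y - lo) ^+ head 0%N (p.1, k :: p.2).2 * gaps y s (behead (p.1, k :: p.2).2)) =
    (y - lo) ^+ k * \sum_(p <- merges (l :: c)) p.1 * gaps y s p.2.
  by rewrite mulr_sumr; apply: eq_bigr => p _ /=; ring.
have := has_RintZ ((y - lo) ^+ k) (IH y (l :: c) ys _).
rewrite /= sc => /(_ erefl); apply: has_Rint_ext => x.
rewrite in_itv /= => /andP[yx _]; case: ifP => // xy /=.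
(* At the shared endpoint, inserting before or after [y] gives the same list. *)
have -> : x = y by apply/le_anti; rewrite xy.
by case: s ys {IH sc} => //= z s /andP[yz _]; rewrite yz.
Qed.

(** For [size c = n.+1], the expected product of the powers [c] of the spacings of [n] uniform
    points; [iint_gaps] justifies this reading. *)
Definition dirichlet n c : R :=
  (n`! * \prod_(k <- c) k`!)%:R / (n + sumn c)`!%:R.

(** Each merge trades one integration variable for one unit of total degree, and the beta
    denominator cancels the factorial of the merged exponent. *)
Lemma mergesP c p : p \in merges c ->
  [/\ size c = (size p.2).+1, sumn p.2 = (sumn c).+1
    & p.1 * (\prod_(k <- p.2) k`!)%:R = (\prod_(k <- c) k`!)%:R].
Proof.
elim: c p => // k [|l c] IH p //; rewrite [merges _]/= inE.
case/predU1P => [->|/mapP[q /IH[sq sumq prodq] ->]] /=.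
  split; rewrite ?addSn ?addnA// !big_cons mulnA !natrM mulrA mulfVK//.
  by rewrite -natrM -factS pnatr_eq0 -lt0n fact_gt0.
move: sq sumq => /= -> ->; split; rewrite ?addnS//.
by rewrite big_cons [in RHS]big_cons [in RHS]natrM -prodq natrM mulrCA.
Qed.

Lemma size_merges c : size (merges c) = (size c).-1.
Proof. by elim: c => // k [|l c] //= IH; rewrite size_map IH. Qed.

(** The [n.+1] merges contribute equally, which turns the factor [n!] into [(n.+1)!]. *)
Lemma sum_merges_dirichlet n c : size c = n.+2 ->
  \sum_(p <- merges c) p.1 * dirichlet n p.2 = dirichlet n.+1 c.
Proof.
move=> sc; rewrite (eq_big_seq (fun=> (n`! * \prod_(k <- c) k`!)%:R /
   (n.+1 + sumn c)`!%:R)); last first.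
  move=> p /mergesP[_ sp pp]; rewrite /dirichlet sp addSnnS mulrA; congr (_ / _).
  by rewrite natrM mulrCA pp natrM.
rewrite big_const_seq count_predT size_merges sc iter_addr_0 -mulrnAl /dirichlet.
by rewrite -mulr_natl -natrM mulnA -factS.
Qed.

Lemma eq_iint k (f g : (nat -> R) -> R) :
  (forall v, (forall j, 0 <= v j <= 1) -> f v = g v) -> iint k f = iint k g.
Proof.
elim: k f g => [|k IH] f g fg /=; first by apply: fg => j; rewrite lexx ler01.
apply: eq_Rintegral => x; rewrite inE /= in_itv /= => x01.
by apply: IH => v v01; apply: fg => j; case: ifP.
Qed.

(** [iint] unfolds at its outermost variable; peeling off coordinate [0], the innermost one, lets
    the induction integrate from inside without exchanging integrals. *)
Lemma iint_innermost k (f : (nat -> R) -> R) :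
  iint k.+1 f = iint k (fun v =>
    Rintegral mu `[0, 1] (fun x => f (fun j => if j is j'.+1 then v j' else x))).
Proof.
elim: k f => [|k IH] f.
  by congr Rintegral; apply/funext => x /=; congr f; apply/funext => -[].
rewrite -[LHS]/(Rintegral mu `[0, 1] (fun y =>
  iint k.+1 (fun v => f (fun j => if j == k.+1 then y else v j)))).
rewrite [RHS]/=; congr Rintegral; apply/funext => y; rewrite IH; congr iint.
apply/funext => v.
by congr Rintegral; apply/funext => x; congr f; apply/funext => -[].
Qed.

(** Weighted lists close the induction: integrating out one variable turns a single gap product into
    a weighted sum of merged ones. *)
Lemma iint_gaps n (L : seq (R * seq nat)) :
  (forall p, p \in L -> size p.2 = n.+1) ->
  iint n (fun v => \sum_(p <- L) p.1 * gaps 0 (sort <=%R [seq v i | i <- iota 0 n]) p.2)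
  = \sum_(p <- L) p.1 * dirichlet n p.2.
Proof.
elim: n L => [|n IH] L szL.
  apply: eq_big_seq => p /szL /=; case: (p.2) => // k [|//] _.
  rewrite /dirichlet big_seq1 /= subr0 expr1n addn0 mul1n divff//.
pose L' := [seq (p.1 * q.1, q.2) | p <- L, q <- merges p.2].
have L'E (h : seq nat -> R) : \sum_(p <- L') p.1 * h p.2 =
    \sum_(p <- L) p.1 * \sum_(q <- merges p.2) q.1 * h q.2.
  rewrite big_allpairs_dep; apply: eq_bigr => p _.
  by rewrite mulr_sumr; apply: eq_bigr => q _; rewrite mulrA.
transitivity (\sum_(p <- L') p.1 * dirichlet n p.2); last first.
  rewrite L'E; apply: eq_big_seq => p pL.
  by rewrite sum_merges_dirichlet// szL.
rewrite -IH; last first.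
  move=> _ /allpairsPdep[p [q [pL /mergesP[sq _ _] ->]]] /=.
  by apply/eq_add_S; rewrite -sq szL.
rewrite iint_innermost; apply: eq_iint => v v01.
rewrite (L'E (gaps 0 (sort <=%R [seq v i | i <- iota 0 n]))).
set s := sort _ _.
have s01 : path <=%R 0 (rcons s 1).
  have sin x : x \in s -> 0 <= x <= 1.
    by rewrite mem_sort => /mapP[j _ ->].
  rewrite rcons_path; apply/andP; split.
    rewrite path_min_sorted ?sort_sorted//; first exact: le_total.
    by apply/allP => x /sin/andP[].
  have := mem_last 0 s; rewrite inE => /predU1P[->|/sin/andP[]//].
  exact: ler01.
have [_ <-] : has_Rint 0 1 (fun x => \sum_(p <- L) p.1 * gaps 0 (insert x s) p.2)
    (\sum_(p <- L) p.1 * \sum_(q <- merges p.2) q.1 * gaps 0 s q.2).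
  apply: has_Rint_sum => p pL; apply/has_RintZ/has_Rint_gaps => //.
  by rewrite szL// size_sort size_map size_iota.
congr Rintegral; apply/funext => x; apply: eq_bigr => p _.
by rewrite -insert_sortE [iota 0 n.+1]/= map_cons (iotaDl 1 0) -map_comp.
Qed.

End GapIntegral.

(** * The law [Pnm] expressed through counts of rankings *)

Section PnmFormula.
Context {R : realType} (n m : nat).
Implicit Types (a : {ffun 'I_m -> 'I_n.+1}).

Definition levels a : seq nat := mkseq (fun l => #|[pred i | a i == l :> nat]|) n.+1.

Definition testlevel a (x : 'I_(n + m)) : nat :=
  if fintype.split x is inr i then a i else 0%N.

Definition calib : pred 'I_(n + m) := [pred x : 'I_(n + m) | (x < n)%N].

Lemma gapsE (lo : R) s c : gaps lo s c = \prod_(l < (size s).+1)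
  (nth 0 (rcons s 1) l - nth 0 (lo :: s) l) ^+ nth 0%N c l.
Proof.
elim: s lo c => [|y s IH] lo c /=; first by rewrite big_ord_recl big_ord0 mulr1 nth0.
rewrite IH [RHS]big_ord_recl nth0; congr (_ * _).
by apply: eq_bigr => l _; rewrite nth_behead.
Qed.

(** Tests of equal level share one mass, so the product groups into powers of spacings; [ustat] at
    [0] and [n.+1] supplies the endpoints. *)
Lemma prod_PUmass (v : nat -> R) a :
  \prod_i PUmass (fun i : 'I_n => v i) (a i).+1 =
  gaps 0 (sort <=%R [seq v i | i <- iota 0 n]) (levels a).
Proof.
rewrite (partition_big a xpredT)//= gapsE size_sort size_map size_iota.
apply: eq_bigr => l _.
rewrite (eq_bigr (fun=> PUmass (fun i : 'I_n => v i) l.+1)); last first.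
  by move=> i /eqP ->.
rewrite prodr_const /levels nth_mkseq//.
congr (_ ^+ _).
rewrite /PUmass /ustat /ordstat /= eqSS.
have -> : [seq v i | i : 'I_n <- enum 'I_n] = [seq v i | i <- iota 0 n].
  by rewrite -val_enum_ord -map_comp.
rewrite nth_rcons size_sort size_map size_iota.
congr (_ - _).
  have [->|ln] := eqVneq (l : nat) n; first by rewrite ltnn.
  by rewrite ltn_neqAle ln -ltnS ltn_ord.
by case: l => -[|l] //= ln; rewrite ltn_eqF// ltnW.
Qed.

Lemma count_enum_split (p : pred 'I_(n + m)) :
  count p (enum 'I_(n + m)) = (#|[pred i | p (lshift m i)]| + #|[pred i | p (rshift n i)]|)%N.
Proof.
by rewrite -sum_mem_count big_enum /= big_split_ord /= -!big_mkcond /= !sum1_card.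
Qed.

Lemma calib_lshift i : calib (lshift m i).
Proof. by rewrite /calib /= ltn_ord. Qed.

Lemma calib_rshift i : calib (rshift n i) = false.
Proof. by rewrite /calib /= ltnNge leq_addr. Qed.

Lemma count_calib : count calib (enum 'I_(n + m)) = n.
Proof.
rewrite count_enum_split (eq_card (B := predT)) ?card_ord; last first.
  by move=> i; rewrite !inE calib_lshift.
by rewrite [X in (_ + X)%N]eq_card0 ?addn0// => i; rewrite !inE calib_rshift.
Qed.

Lemma testlevel_rshift a i : testlevel a (rshift n i) = a i.
Proof. by rewrite /testlevel -[rshift n i]/(unsplit (inr i)) unsplitK. Qed.

Lemma sumn_levels a : sumn (levels a) = m.
Proof.
rewrite sumnE big_map -[iota 0 n.+1]/(index_iota 0 n.+1) big_mkord.
rewrite -[RHS]card_ord -sum1_card (partition_big a xpredT)//=.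
by apply: eq_bigr => l _; rewrite sum1_card.
Qed.

(** The integral and combinatorial sides meet here: both closed forms contain [n!] and the
    factorials of the level sizes. *)
Lemma dirichlet_count a : dirichlet n (levels a) =
  (count (good calib (testlevel a) 0) (permutations (enum 'I_(n + m))))%:R
    / (n + m)`!%:R :> R.
Proof.
rewrite /dirichlet sumn_levels; congr (_%:R / _).
rewrite count_good_permutations ?enum_uniq ?count_calib ?add0n//; last first.
  move=> x _; case: (split_ordP x) => i ->; rewrite ?calib_lshift// => _.
  by rewrite testlevel_rshift leq0n -ltnS ltn_ord.
congr (_ * _)%N; rewrite big_map; apply: eq_bigr => l _; congr _`!.
rewrite count_enum_split [X in (X + _)%N]eq_card0 ?add0n; last first.
  by move=> i; rewrite !inE calib_lshift.
by apply: eq_card => i; rewrite !inE testlevel_rshift calib_rshift.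
Qed.

Lemma Pnm_count (E : ('I_m -> R) -> Prop) :
  Pnm n E = \sum_(a : {ffun 'I_m -> 'I_n.+1} | `[< E (fun i => (a i).+1%:R / n.+1%:R) >])
    (count (good calib (testlevel a) 0) (permutations (enum 'I_(n + m))))%:R / (n + m)`!%:R.
Proof.
(* Encoding the event as exponent lists of weight one lets [iint_gaps] integrate the whole sum at
   once. *)
pose L := [seq (1 : R, levels a) | a <- enum {ffun 'I_m -> 'I_n.+1}
   & `[< E (fun i => (a i).+1%:R / n.+1%:R) >]].
have LE (h : seq nat -> R) : \sum_(p <- L) p.1 * h p.2 =
    \sum_(a : {ffun 'I_m -> 'I_n.+1} | `[< E (fun i => (a i).+1%:R / n.+1%:R) >]) h (levels a).
  by rewrite big_map big_filter big_enum_cond /=; apply: eq_bigr => a _; rewrite mul1r.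
transitivity (\sum_(p <- L) p.1 * dirichlet n p.2); last first.
  by rewrite LE; apply: eq_bigr => a _; rewrite dirichlet_count.
rewrite -iint_gaps; last by move=> _ /mapP[a _ ->]; rewrite size_mkseq.
apply: eq_iint => v _; rewrite LE [RHS]big_mkcond /=.
by apply: eq_bigr => a _; rewrite prod_PUmass; case: asboolP; rewrite ?mulr1 ?mulr0.
Qed.

End PnmFormula.

(** * Reading test levels off a decreasing ranking *)

Section GoodPatterns.
Context {X : eqType} (cal : pred X).
Implicit Types (g : X -> nat) (s : seq X).

Lemma good_eq g g' h s x : good cal g h s -> good cal g' h s ->
  x \in s -> ~~ cal x -> g x = g' x.
Proof.
elim: s h => //= y s IH h; rewrite inE; case: ifP => [cy|_].
  by move=> gs gs' /predU1P[->|]; [rewrite cy|exact: IH gs gs'].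
move=> /andP[/eqP gy gs] /andP[/eqP gy' gs'] /predU1P[-> _|]; first by rewrite gy.
exact: IH gs gs'.
Qed.

Lemma good_decreasing {R : realType} (f : X -> R) g h s x :
  sorted (fun y z => f z < f y) s -> good cal g h s ->
  x \in s -> ~~ cal x -> g x = (h + count (fun y => cal y && (f x <= f y)%R) s)%N.
Proof.
have ftr : transitive (fun y z => f z < f y).
  by move=> y z u yz uy; apply: lt_trans uy yz.
elim: s h => //= y s IH h ys; have ss := path_sorted ys.
have /allP ymin := order_path_min ftr ys.
rewrite inE; case: ifP => [cy gs|/negbT cy /andP[/eqP gy gs]].
  move=> /predU1P[->|xs] cx; first by rewrite cy in cx.
  by rewrite (IH _ ss gs xs cx) ltW ?ymin// addSnnS.
move=> /predU1P[->|xs] cx; rewrite add0n; last exact: IH.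
rewrite gy (eq_in_count (a2 := pred0)) ?count_pred0 ?addn0// => z zs /=.
by rewrite leNgt ymin// andbF.
Qed.

End GoodPatterns.

(** * Uniformity of the ranking of exchangeable scores *)

Section Exchangeable.
Context {R : realType} {d : measure_display} {T : measurableType d}.
Variable N : nat.

(** A pi-system generating the product sigma-algebra on score vectors; exchangeability is stated on
    these sets. *)
Definition boxes : set (set ('I_N -> R)) :=
  [set A | exists2 B : 'I_N -> set R, (forall i, measurable (B i))
    & A = [set x | forall i, B i (x i)]].

Lemma measurable_forall_ord d' (Y : measurableType d') (F : 'I_N -> set Y) :
  (forall i, measurable (F i)) -> measurable [set y | forall i, F i y].
Proof.
move=> mF; rewrite (_ : mkset _ = \bigcap_(i in [set: 'I_N]) F i).
  by apply: fin_bigcap_measurable => //; exact: finite_finset.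
by apply/seteqP; split => y /= h i; [move=> _|]; apply: h.
Qed.

Lemma measurable_decreasing d' (Y : measurableType d') (f : 'I_N -> Y -> R) s :
  (forall i, measurable_fun setT (f i)) ->
  measurable [set y | sorted (fun i j => f j y < f i y) s].
Proof.
move=> mf; case: s => [|i s] /=; first by rewrite (_ : mkset _ = setT) //; apply/seteqP.
elim: s i => [|j s IH] i /=; first by rewrite (_ : mkset _ = setT) //; apply/seteqP.
rewrite (_ : mkset _ = [set y | f j y < f i y] `&`
   [set y | path (fun i j => f j y < f i y) j s]); last first.
  by apply/seteqP; split => y /= /andP.
apply: measurableI => //.
have := measurable_fun_ltr (mf j) (mf i) measurableT (Y := [set true]).
by rewrite setTI; apply.
Qed.

Lemma measurable_coordinate i :
  measurable_fun setT (fun x : g_sigma_algebraType boxes => x i).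
Proof.
move=> _ B mB; rewrite setTI; apply: sub_sigma_algebra.
exists (fun j => if j == i then B else setT).
  by move=> j; case: ifP.
apply/seteqP; split => x /=.
  by move=> Bx j; case: eqP => // ->.
by move/(_ i); rewrite eqxx.
Qed.

Lemma measurable_boxes (S : 'I_N -> T -> R) :
  (forall i, measurable_fun setT (S i)) ->
  measurable_fun setT ((fun w => S^~ w) : T -> g_sigma_algebraType boxes).
Proof.
move=> mS; apply: (@measurability _ _ _ (g_sigma_algebraType boxes) _ _ boxes) => //.
move=> _ [A [B mB ->] <-]; rewrite setTI.
apply: (measurable_forall_ord (F := fun i => S i @^-1` B i)) => i.
by rewrite -[X in measurable X]setTI; apply: mS.
Qed.

Variables (P : probability T R) (S : 'I_N -> T -> R).
Hypothesis mS : forall i, measurable_fun setT (S i).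
Hypothesis exchS : forall (sigma : 'S_N) (B : 'I_N -> set R),
  (forall i, measurable (B i)) ->
  P [set w | forall i, B i (S (sigma i) w)] = P [set w | forall i, B i (S i w)].

(** The laws of the permuted and the original vector agree on [boxes], hence on the generated
    sigma-algebra by uniqueness of measures. *)
Lemma exchangeable_law (sigma : 'S_N) (C : set (g_sigma_algebraType boxes)) :
  measurable C ->
  P [set w | C (fun i => S (sigma i) w)] = P [set w | C (S^~ w)].
Proof.
move=> mC.
have mS1 := measurable_boxes (fun i => mS (sigma i)).
have mS2 := measurable_boxes mS.
pose f1 : {mfun T >-> g_sigma_algebraType boxes} := mfun_Sub (mem_set mS1).
pose f2 : {mfun T >-> g_sigma_algebraType boxes} := mfun_Sub (mem_set mS2).
apply: (@measure_unique _ R (g_sigma_algebraType boxes) boxes (fun=> setT) _ _ _ _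
  (pushforward P f1) (pushforward P f2)) => //.
- move=> _ _ [A mA ->] [B mB ->]; exists (fun i => A i `&` B i).
    by move=> i; apply: measurableI.
  apply/seteqP; split => x /=; first by move=> [Ax Bx] i.
  by move=> ABx; split => i; case: (ABx i).
- by move=> _; exists (fun=> setT) => //; apply/seteqP.
- by rewrite bigcup_const.
- by move=> _ [B mB ->]; apply: exchS.
- by move=> _; rewrite -[X in (X < _)%E]/(P setT) probability_setT ltry.
Qed.

Definition decr s : set T := [set w | sorted (fun i j => S j w < S i w) s].

Let perms := permutations (enum 'I_N).

Lemma measurable_decr s : measurable (decr s).
Proof. exact: measurable_decreasing. Qed.

(** Any ranking is the identity ranking of relabelled scores, and exchangeability absorbs the
    relabelling. *)
Lemma decr_enum s : s \in perms -> P (decr s) = P (decr (enum 'I_N)).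
Proof.
rewrite mem_permutations -val_ord_tuple => /tuple_permP[p ->].
pose C : set (g_sigma_algebraType boxes) :=
  [set x | sorted (fun i j => x j < x i) (enum 'I_N)].
rewrite -[RHS](exchangeable_law p (C := C)); last first.
  by apply: measurable_decreasing => i; apply: measurable_coordinate.
congr (P _); apply/seteqP; split => w;
  rewrite /decr /C /= sorted_map; apply: etrans; apply: eq_sorted => i j /=;
  by rewrite !tnth_ord_tuple.
Qed.

Lemma trivIset_decr : trivIset [set` perms] decr.
Proof.
move=> s s' /=; rewrite !mem_permutations => sp sp' [w [sw sw']].
apply: (irr_sorted_eq (leT := fun i j => S j w < S i w)) => //.
- by move=> i j k ij ki; apply: lt_trans ki ij.
- by apply: perm_mem; rewrite (perm_trans sp)// perm_sym.
Qed.

Hypothesis noties : P [set w | exists i j, i != j /\ S i w = S j w] = 0%E.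

Lemma sum_decr (Q : pred (seq 'I_N)) :
  P (\bigcup_(s in [set` [seq s <- perms | Q s]]) decr s) =
  ((count Q perms)%:R%:E * P (decr (enum 'I_N)))%E.
Proof.
rewrite measure_fin_bigcup//; last 3 first.
- exact: finite_seq.
- apply: sub_trivIset trivIset_decr => s /=; by rewrite mem_filter => /andP[].
- by move=> s _; apply: measurable_decr.
rewrite -fsbig_seq ?filter_uniq ?permutations_uniq//=.
rewrite (eq_big_seq (fun=> P (decr (enum 'I_N)))); last first.
  by move=> s; rewrite mem_filter => /andP[_]; apply: decr_enum.
rewrite -(fineK (fin_num_measure P _ (measurable_decr _))) sumEFin -EFinM.
by rewrite big_const_seq count_predT size_filter iter_addr_0 mulr_natl.
Qed.

Lemma decrE s w : s \in perms ->
  decr s w <-> injective (S^~ w) /\ sorted (fun i j => S j w <= S i w) s.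
Proof.
rewrite mem_permutations => sp.
(* After negation the order is increasing, where strict sortedness splits into uniqueness and weak
   sortedness. *)
have decrE : decr s w = sorted <%R [seq - S i w | i <- s] :> Prop.
  by rewrite sorted_map; congr is_true; apply: eq_sorted => i j /=; rewrite ltrN2.
rewrite decrE lt_sorted_uniq_le sorted_map (perm_uniq (perm_map _ sp)).
rewrite (eq_sorted (e' := fun i j => S j w <= S i w)); last first.
  by move=> i j /=; rewrite lerN2.
have injE : injective (S^~ w) <-> injectiveb (fun i => - S i w).
  split=> [inj|/injectiveP inj]; first by apply/injectiveP => i j /oppr_inj/inj.
  by move=> i j /= Sij; apply: inj; rewrite Sij.
split=> [/andP[u ss]|[/injE u ss]]; first by split => //; apply/injE.
by apply/andP.
Qed.

Lemma cover_decr : ~` (\bigcup_(s in [set` perms]) decr s) =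
  [set w | exists i j, i != j /\ S i w = S j w].
Proof.
apply/seteqP; split => w /=.
  apply: contra_notP => nt.
  have sp : sort (fun i j => S j w <= S i w) (enum 'I_N) \in perms.
    by rewrite mem_permutations perm_sort.
  exists (sort (fun i j => S j w <= S i w) (enum 'I_N)) => //.
  apply/decrE => //; split; last by apply: sort_sorted => i j; apply: le_total.
  by move=> i j Sij; apply/eqP; apply: contra_notT nt => ij; exists i, j.
move=> [i [j [ij Sij]]] [s /= sp] /(decrE _ sp)[inj _].
by move/eqP: ij; apply; apply: inj.
Qed.

(** The [N!] ranking events are disjoint, equally likely, and cover everything outside the null tie
    event. *)
Lemma prob_decr : P (decr (enum 'I_N)) = (N`!%:R^-1)%:E.
Proof.
have mU : measurable (\bigcup_(s in [set` perms]) decr s).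
  apply: fin_bigcup_measurable; first exact: finite_seq.
  by move=> s _; apply: measurable_decr.
have : P (\bigcup_(s in [set` perms]) decr s) = 1%E.
  by rewrite -[X in P X]setCK probability_setC ?cover_decr ?noties ?sube0// -cover_decr;
    apply: measurableC.
have := sum_decr predT; rewrite filter_predT count_predT => ->.
rewrite size_permutations ?enum_uniq// size_enum_ord.
rewrite -(fineK (fin_num_measure P _ (measurable_decr _))) -EFinM => -[] h.
congr EFin; apply: (mulfI (x := N`!%:R)); last by rewrite h divff// pnatr_eq0 -lt0n fact_gt0.
by rewrite pnatr_eq0 -lt0n fact_gt0.
Qed.

Lemma prob_ge_count (Q : pred (seq 'I_N)) (A : set T) : measurable A ->
  (forall s w, s \in perms -> Q s -> decr s w -> A w) ->
  (((count Q perms)%:R / N`!%:R)%:E <= P A)%E.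
Proof.
move=> mA QA; rewrite EFinM -prob_decr -sum_decr; apply: le_measure; rewrite ?inE//.
  apply: fin_bigcup_measurable; first exact: finite_seq.
  by move=> s _; apply: measurable_decr.
move=> w [s /=]; rewrite mem_filter => /andP[Qs sp]; exact: QA.
Qed.

(** Membership depends only on the table [cmp w], which takes finitely many values, each on a
    measurable set. *)
Lemma measurable_comparisons (A : set T) :
  (forall w w', (forall i j, (S i w <= S j w) = (S i w' <= S j w')) -> A w -> A w') ->
  measurable A.
Proof.
move=> Ainv; pose cmp w := [ffun ij : 'I_N * 'I_N => S ij.1 w <= S ij.2 w].
rewrite (_ : A = \bigcup_(b in cmp @` A) [set w | forall i j, (S i w <= S j w) = b (i, j)]).
  apply: fin_bigcup_measurable; first exact: finite_finset.
  move=> b _; apply: (measurable_forall_ord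
    (F := fun i => [set w | forall j, (S i w <= S j w) = b (i, j)])) => i.
  apply: (measurable_forall_ord (F := fun j => [set w | (S i w <= S j w) = b (i, j)])) => j.
  have := measurable_fun_ler (mS i) (mS j) measurableT (Y := [set b (i, j)]).
  by rewrite setTI; apply.
apply/seteqP; split => [w Aw|w [_ [w' Aw' <-]] /= h].
  by exists (cmp w) => [|i j /=]; [exists w|rewrite ffunE].
by apply: Ainv Aw' => i j; rewrite h ffunE.
Qed.

End Exchangeable.

(** * Order statistics, generalized inverses and the finite grid [Lambda] *)

Section Deterministic.
Context {R : realType}.

Lemma card_mkset (I : finType) (p : pred I) : #|[set i | p i]| = #|p|.
Proof. by apply: eq_card => i; apply/idP/idP; rewrite inE. Qed.

Lemma count_lt_sort_nth (s : seq R) (y : R) j :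
  (j < size s)%N -> y < nth 0 (sort <=%R s) j -> (count (fun x => x <= y)%R s <= j)%N.
Proof.
move=> js yj; rewrite -(count_sort <=%R); set u := sort _ _.
have su : sorted <=%R u by apply: sort_sorted; exact: le_total.
rewrite -(cat_take_drop j u) count_cat.
rewrite [X in (_ + X)%N](_ : _ = 0%N) ?addn0.
  by apply: leq_trans (count_size _ _) _; rewrite size_take_min geq_minl.
apply/eqP; rewrite -leqn0 leqNgt -has_count; apply/hasPn => x.
move=> /(nthP 0)[k]; rewrite size_drop size_sort nth_drop => kj <-.
rewrite -ltNge; apply: lt_le_trans yj _.
apply: (sorted_leq_nth le_trans le_refl) => //; rewrite ?inE ?size_sort ?leq_addr//.
by rewrite -ltn_subRL.
Qed.

Lemma tinv_ge0 (t : R -> R) x : 0 <= tinv t x.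
Proof.
rewrite /tinv; set A := mkset _.
have [->|/set0P[l Al]] := eqVneq A set0; first by rewrite sup0.
case: (Al) => /andP[l0 _] _; apply: le_trans l0 _; apply: ub_le_sup => //.
by exists 1 => y [/andP[]].
Qed.

(** Some [l > lam] has [t l <= x], and [t] is strictly increasing. If the set under [sup] were
    empty, [tinv] would be [0], which [0 <= lam] excludes. *)
Lemma lt_tinv (t : R -> R) lam x : template_fun t -> 0 <= lam ->
  lam < tinv t x -> t lam < x.
Proof.
move=> [_ _ incr] lam0; rewrite /tinv; set A := mkset _ => lams.
have [A0|/set0P A0] := eqVneq A set0.
  by move: lams; rewrite A0 sup0 ltNge lam0.
have [l [/andP[l0 l1] tl] laml] := sup_gt A0 lams.
apply: lt_le_trans tl; apply: incr => //; rewrite in_itv /= ?lam0 ?l0 ?l1//.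
by rewrite (le_trans (ltW laml)).
Qed.

Lemma minevent_card m (K : {set 'I_m.+1}) (t : 'I_m.+1 -> R -> R) lam (q : 'I_m -> R) k :
  template_fun (t k) -> (0 < k)%N -> k \in K -> 0 <= lam -> minevent K t lam q ->
  (#|[set i | (q i <= t k lam)%R]| <= k)%N.
Proof.
move=> tk k0 kK lam0 /(_ k kK)/(lt_tinv tk lam0) qk.
rewrite card_mkset -sum1_card big_mkcond /= -big_enum /= (sum_mem_count (fun i => q i <= t k lam)).
rewrite -(count_map q (fun x => x <= t k lam)).
(* [ordstat] is one-based: the [k]-th smallest value sits at position [k.-1], so in fact at most
   [k.-1] values reach the count. *)
apply: leq_trans (leq_pred k); apply: count_lt_sort_nth => //.
by rewrite size_map size_enum_ord prednK// -ltnS.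
Qed.

Lemma finite_max (A : set R) : finite_set A -> A !=set0 -> A (sup A).
Proof.
move=> /finite_seqP[s ->] s0.
have [M Ms MP] : exists2 M, M \in s & forall y, y \in s -> y <= M.
  elim: s s0 => [[]//|x s IH _].
  case: s IH => [_|y s /(_ (ex_intro _ y (mem_head y s)))[M Ms MP]].
    by exists x; rewrite ?mem_head// => y; rewrite inE => /eqP ->.
  have [Mx|xM] := leP M x.
    exists x; rewrite ?mem_head// => z; rewrite inE => /predU1P[->//|/MP zM].
    exact: le_trans zM Mx.
  exists M; first by rewrite inE Ms orbT.
  by move=> z; rewrite inE => /predU1P[->|/MP//]; apply: ltW.
suff -> : sup [set` s] = M by [].
apply/le_anti/andP; split; first exact: ge_sup.
by apply: ub_le_sup => //; exists M.
Qed.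

Lemma finite_Lambda n m (K : {set 'I_m.+1}) (t : 'I_m.+1 -> R -> R) :
  finite_set (Lambda n K t).
Proof.
pose f (kl : 'I_m.+1 * 'I_n.+2) := tinv (t kl.1) (kl.2%:R / n.+1%:R).
apply: (@sub_finite_set _ _ (f @` setT)); last exact/finite_image/finite_finset.
move=> _ [k [l [_ [/andP[_ ln] ->]]]].
by exists (k, Ordinal (ln : (l < n.+2)%N)).
Qed.

End Deterministic.

(** * Transfer from rankings to conformal p-values *)

Section PatternProbability.
Context {R : realType} (n m : nat).

Definition pattern (Eb : pred {ffun 'I_m -> 'I_n.+1}) (s : seq 'I_(n + m)) : bool :=
  [exists a, Eb a && good (@calib n m) (testlevel a) 0 s].

(** By [good_eq] a ranking determines the level of every test, so it is counted for at most one
    [a]. *)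
Lemma sum_count_good Eb :
  (\sum_(a | Eb a) count (good (@calib n m) (testlevel a) 0) (permutations (enum 'I_(n + m)))
   <= count (pattern Eb) (permutations (enum 'I_(n + m))))%N.
Proof.
under eq_bigr do rewrite -sum_mem_count.
rewrite exchange_big /= -sum_mem_count.
rewrite [X in (X <= _)%N]big_seq [X in (_ <= X)%N]big_seq.
apply: leq_sum => s; rewrite mem_permutations => /perm_mem sE.
rewrite -big_mkcondr sum1_card.
have [_|/existsPn no] := boolP (pattern Eb s); last first.
  by rewrite eq_card0// => a; rewrite !inE; apply/negbTE/no.
apply/card_le1_eqP => a a' /andP[_ ga] /andP[_ ga'].
apply/ffunP => i; apply/val_inj => /=.
rewrite -2!testlevel_rshift; apply: (good_eq ga' ga); last by rewrite calib_rshift.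
by rewrite sE mem_enum.
Qed.

(** In a decreasing ranking, the calibration scores met before test [i] are exactly those that
    [pval] counts. *)
Lemma pval_good (x : 'I_(n + m) -> R) a s : s \in permutations (enum 'I_(n + m)) ->
  sorted (fun i j => x j < x i) s -> good (@calib n m) (testlevel a) 0 s ->
  Defs.pval x = fun i => (a i).+1%:R / n.+1%:R.
Proof.
move=> sp xs gs; apply/funext => i; rewrite /Defs.pval nat1r; congr (_.+1%:R / _).
rewrite mem_permutations in sp.
have := good_decreasing xs gs (x := rshift n i).
rewrite (perm_mem sp) mem_enum calib_rshift testlevel_rshift => -> //.
rewrite add0n (seq.permP sp) count_enum_split.
rewrite [X in (_ + X)%N]eq_card0 ?addn0; last by move=> j; rewrite !inE calib_rshift.
by rewrite card_mkset; apply: eq_card => j; rewrite !inE calib_lshift.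
Qed.

End PatternProbability.

Theorem theorem3 (R : realType) (d : measure_display) (T : measurableType d)
  (P : probability T R) (n m : nat) (S : 'I_(n + m) -> T -> R)
  (K : {set 'I_m.+1}) (t : 'I_m.+1 -> R -> R) (delta : R) :
  (1 <= n)%N -> (1 <= m)%N ->
  (forall i, measurable_fun setT (S i)) ->
  (* exchangeability: the joint law is invariant under permutations *)
  (forall (sigma : 'S_(n + m)) (B : 'I_(n + m) -> set R),
      (forall i, measurable (B i)) ->
      P [set w | forall i, B i (S (sigma i) w)] = P [set w | forall i, B i (S i w)]) ->
  (* almost surely no ties *)
  P [set w | exists i j, i != j /\ S i w = S j w] = 0%E ->
  (* K is a subset of {1,...,m} *)
  (forall k, k \in K -> (0 < k)%N) ->
  (* template *)
  (forall k, k \in K -> template_fun (t k)) ->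
  0 < delta < 1 ->
  ((1 - delta)%:E <=
     P [set w | forall k, k \in K ->
          (Fhat (fun i => S i w) (t k (lamsel n K t delta)) <= (nat_of_ord k)%:R / m%:R)%R])%E.
Proof.
move=> _ m1 mS exchS noties K0 tK /andP[delta0 _].
(* The p-values depend only on pairwise comparisons, which yields measurability of the target
   event. *)
have pE w w' : (forall i j, (S i w <= S j w) = (S i w' <= S j w')) ->
    Defs.pval (S^~ w) = Defs.pval (S^~ w').
  move=> h; apply/funext => i; rewrite /Defs.pval; congr ((1 + _%:R) / _).
  by rewrite !card_mkset; apply: eq_card => j; exact: h.
have mA lam : measurable [set w | forall k, k \in K ->
    Fhat (S^~ w) (t k lam) <= k%:R / m%:R].
  apply: (measurable_comparisons mS) => w w' /pE h A k kK.
  by rewrite /Fhat -h; apply: A.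
rewrite /lamsel; set A := (X in `[< X !=set0 >]); case: asboolP => [A0|_].
  (* The grid is finite, so the supremum is attained and itself satisfies the probability bound. *)
  have [[k [l [kK [_ supE]]]] supP] : A (sup A).
    by apply: finite_max => //; apply: sub_finite_set (finite_Lambda n K t) => x [].
  have sup0 : 0 <= sup A by rewrite supE tinv_ge0.
  rewrite Pnm_count -mulr_suml -natr_sum in supP.
  pose Eb : pred {ffun 'I_m -> 'I_n.+1} := fun a =>
    `[< minevent K t (sup A) (fun i => (a i).+1%:R / n.+1%:R) >].
  apply: (@le_trans _ _ ((count (pattern Eb) (permutations (enum 'I_(n + m))))%:R
      / (n + m)`!%:R)%:E).
    rewrite lee_fin; apply: le_trans supP _.
    by rewrite ler_pM2r ?invr_gt0 ?ltr0n ?fact_gt0// ler_nat; exact: sum_count_good.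
  apply: (prob_ge_count mS exchS noties) => // s w sp /existsP[a /andP[/asboolP Ea ga]] sw k' k'K.
  rewrite /Fhat ler_pM2r ?invr_gt0 ?ltr0n// ler_nat (pval_good sp sw ga).
  exact: (minevent_card (K := K)) (tK _ k'K) (K0 _ k'K) k'K sup0 Ea.
(* For an empty set the selected value is [0]; every p-value is positive while [t k 0 = 0], so
   [Fhat] vanishes and the event is certain. *)
rewrite (_ : mkset _ = setT) ?probability_setT ?lee_fin ?gerBl ?(ltW delta0)//.
apply/seteqP; split => // w _ k kK /=.
have [-> _ _] := tK k kK.
rewrite /Fhat card_mkset eq_card0 ?mul0r ?divr_ge0// => i.
apply/negbTE; rewrite -topredE /= -ltNge /Defs.pval.
by rewrite divr_gt0 ?ltr0n// ltr_pwDl.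
Qed.
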